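(* Every (possibly randomized) online algorithm $R$ for Edge-2-Coloring(Path) satisfies $C_{R}^{\text{Path}}(2)\le\frac45$.
   Context: Online dual edge coloring, Edge-$k$-Coloring: a number $k$ of colors $1,\dots,k$ is given. The edges of a simple graph arrive one by one, each specified by its two endpoints. Upon arrival, an edge must irrevocably either be colored with one of the $k$ colors, such that no two adjacent (sharing an endpoint) colored edges receive the same color, or be rejected. The goal is to color as many edges as possible. Edge-2-Coloring(Path) is the case $k=2$ with the input graph being a path. Competitive ratio: for an input sequence $\sigma$, let $E[R(\sigma)]$ be the expected number of edges colored by $R$ (the exact number if $R$ is deterministic) and $\mathrm{OPT}(\sigma)$ the maximum number of edges of the input graph that can be properly colored with $k$ colors. $R$ is $C$-competitive if there is a constant $b$ with $E[R(\sigma)]\ge C\cdot\mathrm{OPT}(\sigma)-b$ for all inputs $\sigma$; the competitive ratio $C_R^{\text{Path}}(2)$ is the supremum of all such $C$. *)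

(* Defs.v *)
From mathcomp Require Import all_boot all_order all_algebra finmap.
From mathcomp Require Import all_classical all_reals all_analysis.

Set Implicit Arguments.
Unset Strict Implicit.
Unset Printing Implicit Defensive.

Import Order.TTheory GRing.Theory Num.Theory.

Local Open Scope classical_set_scope.
Local Open Scope ring_scope.

(* An edge is the unordered pair of its endpoints. Vertices are labelled by
   natural numbers, so there are infinitely many of them and their number is
   not known to an algorithm in advance. *)
Definition edge := {fset nat}.

Definition adjacent (e f : edge) : bool := (e `&` f != fset0)%fset.

Definition path_edges (p : seq nat) : seq edge :=
  [seq [fset uv.1; uv.2]%fset | uv <- zip p (behead p)].

(* The edges of a single path (pairwise distinct vertices), in any order. *)
Definition path_input : set (seq edge) :=
  [set s | exists2 p : seq nat, uniq p & perm_eq s (path_edges p)].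

(* c lists the outcomes for the successive edges of s; None means rejected. *)
Definition proper_coloring (k : nat) (s : seq edge) (c : seq (option 'I_k)) :
    bool :=
  (size c == size s) &&
  [forall i : 'I_(size s), forall j : 'I_(size s),
     [&& i != j, adjacent (nth fset0 s i) (nth fset0 s j)
       & nth None c i != None] ==> (nth None c i != nth None c j)].

Definition num_colored (k : nat) (c : seq (option 'I_k)) : nat :=
  count isSome c.

Definition OPT (k : nat) (s : seq edge) : nat :=
  (\max_(c : (size s).-tuple (option 'I_k) | proper_coloring s c)
     num_colored c)%N.

(* The outcome for a new edge, as a function of the edges that arrived before
   it (in order of arrival) and of the new edge itself. The earlier outcomes
   of a deterministic algorithm are determined by these data. *)
Definition decision_rule (k : nat) := seq edge -> edge -> option 'I_k.

Fixpoint run_from (k : nat) (D : decision_rule k) (past s : seq edge) :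
    seq (option 'I_k) :=
  if s is e :: s' then D past e :: run_from D (rcons past e) s' else [::].

Definition run (k : nat) (D : decision_rule k) (s : seq edge) :
    seq (option 'I_k) := run_from D [::] s.

(* A randomized algorithm for Edge-k-Coloring on a class I of inputs: a random
   decision rule, T being the sample space of its internal randomness. It has
   to produce a proper coloring on inputs in I only. *)
Record online_algorithm (k : nat) (I : set (seq edge)) d
    (T : measurableType d) := OnlineAlgorithm {
  decide :> T -> decision_rule k;
  decide_measurable : forall (past : seq edge) (e : edge) (o : option 'I_k),
    measurable [set w | decide w past e = o];
  decide_proper : forall (w : T) (s : seq edge), I s ->
    proper_coloring s (run (decide w) s) }.

Definition expected_colored (R : realType) (k : nat) (I : set (seq edge)) d
    (T : measurableType d) (P : probability T R) (A : online_algorithm k I T)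
    (s : seq edge) : \bar R :=
  'E_P[fun w => (num_colored (run (A w) s))%:R].

Definition competitive (R : realType) (k : nat) (I : set (seq edge)) d
    (T : measurableType d) (P : probability T R) (A : online_algorithm k I T)
    (C : R) : Prop :=
  exists b : R, forall s : seq edge, I s ->
    ((C * (OPT k s)%:R - b)%:E <= expected_colored P A s)%E.

Definition competitive_ratio (R : realType) (k : nat) (I : set (seq edge)) d
    (T : measurableType d) (P : probability T R) (A : online_algorithm k I T) :
    \bar R :=
  ereal_sup [set C%:E | C in [set C : R | competitive P A C]].

(* Main.v *)
(* The adversary first presents the n+1 disjoint edges {3i, 3i+1} and then joins
   consecutive ones into a single path, either by one connecting edge each or by
   two connecting edges each. If both neighbours of a junction are colored, then
   a single connecting edge is lost when their colors differ, and one of two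
   connecting edges is lost when their colors agree; a rejected initial edge is
   lost in both continuations, which share their first n+1 outcomes, and so pays
   for the junctions at both of its ends. Hence at least n of the 5n+2 edges of
   the two paths together are lost, while OPT colors all of them. Taking
   expectations and letting n grow gives 4/5. *)
Require Import Defs.
From mathcomp Require Import all_boot all_order all_algebra finmap zify lra.
From mathcomp Require Import all_classical all_reals all_analysis.
From mathcomp Require Import measurable_realfun.

Import Order.TTheory GRing.Theory Num.Theory.

Local Open Scope nat_scope.

(** * Path inputs described by positions along the path *)

Definition path_edge (g : nat -> nat) (j : nat) : edge := [fset g j; g j.+1]%fset.

Section PathInputs.
Variables (g : nat -> nat) (N : nat) (r : seq nat).
Hypotheses (g_inj : injective g) (r_perm : perm_eq r (iota 0 N)).

Lemma path_edges_mkseq :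
  path_edges (mkseq g N.+1) = map (path_edge g) (iota 0 N).
Proof.
rewrite /path_edges /mkseq; elim: N 0 => //= n IH m.
by rewrite -(IH m.+1).
Qed.

Lemma path_input_map : path_input (map (path_edge g) r).
Proof.
exists (mkseq g N.+1); first by rewrite mkseq_uniq.
by rewrite path_edges_mkseq perm_map.
Qed.

Lemma adjacent_path_edge i j : Defs.adjacent (path_edge g i) (path_edge g j) =
  (i <= j.+1) && (j <= i.+1).
Proof.
apply/idP/idP.
  case/fset0Pn => x; rewrite !inE.
  by case/andP=> /orP[]/eqP-> /orP[]; rewrite (inj_eq g_inj) => /eqP; lia.
move=> ij; have : i = j \/ i = j.+1 \/ j = i.+1 by lia.
by case=> [E|[E|E]]; apply/fset0Pn;
  [exists (g i)|exists (g i)|exists (g j)]; rewrite !inE E eqxx ?orbT.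
Qed.

(** Outcomes come listed by arrival time; indexing them by position on the path lets runs with
    different arrival orders be compared. *)
Lemma proper_coloring_path k (c : seq (option 'I_k)) :
  proper_coloring (map (path_edge g) r) c ->
  exists2 col : nat -> option 'I_k, c = map col r &
    forall j, j.+1 < N -> col j != None -> col j != col j.+1.
Proof.
case/andP; rewrite size_map => /eqP sc /forallP /= H.
have r_uniq : uniq r by rewrite (perm_uniq r_perm) iota_uniq.
have rE j : (j \in r) = (j < N) by rewrite (perm_mem r_perm) mem_iota.
(* [index j r] is the arrival time of edge [j]. *)
exists (fun j => nth None c (index j r)).
  apply: (@eq_from_nth _ None) => [|i]; first by rewrite size_map.
  by rewrite sc => ir; rewrite (nth_map 0) // index_uniq.
move=> j jN cj.
have jr : index j r < size r by rewrite index_mem rE ltnW.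
have j1r : index j.+1 r < size r by rewrite index_mem rE.
have /forallP/(_ (Ordinal j1r))/implyP := H (Ordinal jr).
rewrite -val_eqE /=; apply.
rewrite !(nth_map 0) // !nth_index ?rE ?(ltnW jN) // cj adjacent_path_edge andbT.
apply/andP; split; last lia.
by apply/eqP => /(congr1 (nth 0 r)); rewrite !nth_index ?rE ?(ltnW jN) //; lia.
Qed.

(** Coloring by the parity of the position is proper and rejects nothing. *)
Lemma OPT_path : N <= OPT 2 (map (path_edge g) r).
Proof.
set s := map _ _.
have szr : size r = N by rewrite (perm_size r_perm) size_iota.
pose c : seq (option 'I_2) := map (fun j => Some (inord (odd j))) r.
have sc : size c == size s by rewrite !size_map.
have numc : num_colored c = N by rewrite /num_colored count_map -szr -count_predT.
rewrite -numc /OPT; apply: (@leq_bigmax_cond _ _ _ (Tuple sc)).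
rewrite /proper_coloring sc /=; apply/forallP => i; apply/forallP => j.
apply/implyP => /and3P[ij + _].
have [ir jr] : i < size r /\ j < size r.
  by case: i j ij => [i +] [j +] _; rewrite !size_map.
rewrite !(nth_map 0) // adjacent_path_edge => adj.
apply/eqP => -[/(congr1 val)]; rewrite /= !inordK; try by case: odd.
have : nth 0 r i != nth 0 r j.
  by rewrite nth_uniq ?(perm_uniq r_perm) ?iota_uniq.
lia.
Qed.

End PathInputs.

Lemma size_run_from k (D : decision_rule k) past s :
  size (run_from D past s) = size s.
Proof. by elim: s past => //= e s IH past; rewrite IH. Qed.

Lemma run_from_cat k (D : decision_rule k) past s1 s2 :
  run_from D past (s1 ++ s2) = run_from D past s1 ++ run_from D (past ++ s1) s2.
Proof.
by elim: s1 past => [|e s1 IH] past /=; rewrite ?cats0 // IH cat_rcons.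
Qed.

(** * The two adversarial inputs and the edges lost on them *)

Section Adversary.
Variable n : nat.

(* The path 0, 1, 3, 4, 6, 7, ..., whose edges of even index are {3i, 3i+1}. *)
Definition label1 (j : nat) := j + j./2.

(** Here the initial edges sit at the even positions, in [order2] at the multiples of 3; both orders
    present them first. *)
Definition order1 :=
  [seq 2 * i | i <- iota 0 n.+1] ++ [seq 2 * i + 1 | i <- iota 0 n].

Definition order2 := [seq 3 * i | i <- iota 0 n.+1] ++
  ([seq 3 * i + 1 | i <- iota 0 n] ++ [seq 3 * i + 2 | i <- iota 0 n]).

Definition input1 := [seq path_edge label1 j | j <- order1].

Definition input2 := [seq path_edge id j | j <- order2].

Lemma label1_inj : injective label1.
Proof. by move=> i j; rewrite /label1; lia. Qed.

Lemma perm_iota (N : nat) (r : seq nat) :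
  size r <= N -> (forall j, j < N -> j \in r) -> perm_eq r (iota 0 N).
Proof.
move=> szr mr.
have sub : {subset iota 0 N <= r} by move=> j; rewrite mem_iota; exact: mr.
have szr' : size r <= size (iota 0 N) by rewrite size_iota.
have [_ rE] := uniq_min_size (iota_uniq 0 N) sub szr'.
apply: uniq_perm; rewrite ?iota_uniq //.
exact: leq_size_uniq (iota_uniq 0 N) sub szr'.
Qed.

Lemma perm_order1 : perm_eq order1 (iota 0 (2 * n).+1).
Proof.
apply: perm_iota => [|j jn].
  by rewrite /order1 size_cat !size_map !size_iota; lia.
rewrite mem_cat; apply/orP.
have [jo|jo] := boolP (odd j); [right|left]; apply/mapP; exists j./2;
  rewrite ?mem_iota; lia.
Qed.

Lemma perm_order2 : perm_eq order2 (iota 0 (3 * n).+1).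
Proof.
apply: perm_iota => [|j jn].
  by rewrite /order2 !size_cat !size_map !size_iota; lia.
rewrite !mem_cat; apply/or3P.
have : j %% 3 < 3 by rewrite ltn_mod.
case E : (j %% 3) => [|[|[|//]]] _; [apply: Or31|apply: Or32|apply: Or33];
  apply/mapP; exists (j %/ 3); rewrite ?mem_iota; lia.
Qed.

(** Since [label1] skips the numbers 2 modulo 3, both inputs start with the same edges, and a
    decision rule cannot tell them apart until the junctions arrive. *)
Lemma input_prefixE :
  [seq path_edge label1 j | j <- [seq 2 * i | i <- iota 0 n.+1]] =
  [seq path_edge id j | j <- [seq 3 * i | i <- iota 0 n.+1]].
Proof.
rewrite -!map_comp; apply: eq_map => i /=.
rewrite /path_edge /label1.
have -> : 2 * i + (2 * i)./2 = 3 * i by lia.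
by have -> : (2 * i).+1 + (2 * i).+1./2 = (3 * i).+1 by lia.
Qed.

(** Summing over junctions counts every inner initial edge twice, which matches its occurrence in
    both inputs. The two end edges border only one junction each, whence [c 0 + c n]. *)
Lemma count_junctions (c x y z : nat -> bool) :
    (forall i, i < n -> c i + c i.+1 + x i + y i + z i <= 4) ->
  2 * count c (iota 0 n.+1) + count x (iota 0 n) + count y (iota 0 n)
    + count z (iota 0 n) <= 4 * n + c 0 + c n.
Proof.
elim: n => [|m IH] H; first by rewrite /=; lia.
have iotaS k : iota 0 k.+1 = iota 0 k ++ [:: k] by rewrite -addn1 iotaD.
have := H m (ltnSn m); have := IH (fun i im => H i (ltnW im)).
by rewrite (iotaS m.+1) (iotaS m) !count_cat /=; lia.
Qed.

(* a and b are the outcomes of two neighbouring initial edges, x that of the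
   single connecting edge, and y, z those of the two connecting edges. *)
Lemma junction (a b x y z : option 'I_2) :
    (a != None) ==> (a != x) -> (x != None) ==> (x != b) ->
    (a != None) ==> (a != y) -> (y != None) ==> (y != z) ->
    (z != None) ==> (z != b) ->
  isSome a + isSome b + isSome x + isSome y + isSome z <= 4.
Proof.
case: x => [[[|[|//]] ?]|]; case: y => [[[|[|//]] ?]|];
by case: a => [[[|[|//]] ?]|]; case: b => [[[|[|//]] ?]|];
   case: z => [[[|[|//]] ?]|].
Qed.

Lemma num_colored_inputs_le (D : decision_rule 2) :
    (forall s, path_input s -> proper_coloring s (run D s)) ->
  num_colored (run D input1) + num_colored (run D input2) <= 4 * n + 2.
Proof.
move=> Dproper.
have [c1 run1 c1P] := proper_coloring_path _ _ _ label1_inj perm_order1 _ _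
  (Dproper _ (path_input_map _ _ _ label1_inj perm_order1)).
have [c2 run2 c2P] := proper_coloring_path _ _ _ (@inj_id _) perm_order2 _ _
  (Dproper _ (path_input_map _ _ _ (@inj_id _) perm_order2)).
(* The first [n.+1] outcomes of the two runs coincide. *)
have c12 i : i <= n -> c1 (2 * i) = c2 (3 * i).
  move=> iN.
  have := congr1 (take n.+1) run1; have := congr1 (take n.+1) run2.
  rewrite /run !map_cat !run_from_cat -input_prefixE.
  rewrite !take_size_cat ?size_run_from ?size_map ?size_iota // => -> /esym.
  rewrite -!map_comp => /(congr1 (fun s => nth None s i)).
  by rewrite !(nth_map 0) ?size_iota // !nth_iota.
have count_mapE (c : nat -> option 'I_2) f s :
    count isSome (map c (map f s)) = count (fun i => isSome (c (f i))) s.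
  by rewrite !count_map.
rewrite /num_colored run1 run2 !map_cat !count_cat !count_mapE; cbv beta.
have -> : count (fun i => isSome (c1 (2 * i))) (iota 0 n.+1) =
          count (fun i => isSome (c2 (3 * i))) (iota 0 n.+1).
  by apply: eq_in_count => i; rewrite mem_iota => /andP[_ iN]; rewrite /= c12.
have := count_junctions (fun i => isSome (c2 (3 * i)))
  (fun i => isSome (c1 (2 * i + 1))) (fun i => isSome (c2 (3 * i + 1)))
  (fun i => isSome (c2 (3 * i + 2))).
suff H : forall i, i < n -> isSome (c2 (3 * i)) + isSome (c2 (3 * i.+1)) +
    isSome (c1 (2 * i + 1)) + isSome (c2 (3 * i + 1)) +
    isSome (c2 (3 * i + 2)) <= 4.
  (* The additive 2 in the goal bounds the contribution of the two end edges. *)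
  by move=> /(_ H); lia.
move=> i iN.
have step1 j j' : j' = j.+1 -> j' < (2 * n).+1 ->
  (c1 j != None) ==> (c1 j != c1 j') by move=> -> /c1P/implyP.
have step2 j j' : j' = j.+1 -> j' < (3 * n).+1 ->
  (c2 j != None) ==> (c2 j != c2 j') by move=> -> /c2P/implyP.
apply: junction.
- by rewrite -c12; [apply: step1|]; lia.
- by rewrite -c12; [apply: step1|]; lia.
- by apply: step2; lia.
- by apply: step2; lia.
- by apply: step2; lia.
Qed.

End Adversary.

Local Open Scope ring_scope.

(** * From fixed randomness to expectations *)

Section Expectation.
Context {R : realType} {k : nat} {I : set (seq edge)} {d : measure_display}.
Context {T : measurableType d} (P : probability T R).
Variable A : online_algorithm k I T.

Lemma measurable_num_colored (s : seq edge) :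
  measurable_fun [set: T] (fun w => (num_colored (run (A w) s))%:R : R).
Proof.
rewrite /run; move: [::] => past; elim: s past => [|e s IH] past /=.
  exact: measurable_cst.
(* The first outcome contributes the indicator of the event that its edge is not rejected. *)
have -> : (fun w => (num_colored (A w past e :: run_from (A w) (rcons past e) s))%:R) =
  \1_(~` [set w | A w past e = None]) \+
  (fun w => (num_colored (run_from (A w) (rcons past e) s))%:R) :> (T -> R).
  apply/funext => w; rewrite /num_colored /= natrD indicE in_setC.
  congr ((nat_of_bool _)%:R + _).
  apply/idP/negP; rewrite inE /=; first by case: (A w past e).
  by case: (A w past e) => [c|] // [].
apply: measurable_funD => //; apply: measurable_indic; apply: measurableC.
exact: decide_measurable.
Qed.

(** A bound valid for each fixed [w] survives averaging, as [P] has total mass 1. *)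
Lemma expected_colored_add_le (s t : seq edge) (m : nat) :
    (forall w, (num_colored (run (A w) s) + num_colored (run (A w) t) <= m)%N) ->
  (expected_colored P A s + expected_colored P A t <= (m%:R)%:E)%E.
Proof.
move=> le_m; rewrite /expected_colored expectation.unlock.
have mE u : measurable_fun [set: T]
    (fun w => ((num_colored (run (A w) u))%:R : R)%:E).
  exact/measurable_EFinP/measurable_num_colored.
rewrite -ge0_integralD //.
have <- : (\int[P]_w cst (m%:R : R)%:E w = (m%:R)%:E)%E.
  by rewrite integral_cst // [X in (_ * X)%E]probability_setT mule1.
apply: ge0_le_integral => //.
- by move=> w _; rewrite adde_ge0.
- exact: emeasurable_funD.
- by move=> w _; rewrite -EFinD lee_fin -natrD ler_nat.
Qed.

End Expectation.

Theorem theorem2 (R : realType) (d : measure_display) (T : measurableType d)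
    (P : probability T R) (A : online_algorithm 2 path_input T) :
  (competitive_ratio P A <= (4 / 5 : R)%:E)%E.
Proof.
apply: ge_ereal_sup => _ [C [b Cb] <-]; rewrite lee_fin leNgt; apply/negP => C45.
have C45' : 0 < C - 4 / 5 by rewrite subr_gt0.
(* Adding the two competitiveness bounds gives [C * (5n + 2) - 2b <= 4n + 2]; the constant 2/5
   bounds [2 - 2C], because C exceeds 4/5. *)
have bound n : 5 * ((C - 4 / 5) * n%:R) <= 2 * b + 2 / 5.
  have i1 := path_input_map _ _ _ label1_inj (perm_order1 n).
  have i2 := path_input_map _ _ _ (@inj_id _) (perm_order2 n).
  have opt1 : 2 * n%:R + 1 <= (OPT 2 (input1 n))%:R :> R.
    by rewrite -natrM natr1 ler_nat; exact: OPT_path label1_inj (perm_order1 n).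
  have opt2 : 3 * n%:R + 1 <= (OPT 2 (input2 n))%:R :> R.
    by rewrite -natrM natr1 ler_nat; exact: OPT_path (@inj_id _) (perm_order2 n).
  have := expected_colored_add_le P A _ _ _
    (fun w => num_colored_inputs_le n (A w) (decide_proper A w)).
  move=> /(le_trans (leeD (Cb _ i1) (Cb _ i2))); rewrite -EFinD lee_fin.
  rewrite -/(input1 n) -/(input2 n) natrD natrM.
  nra.
(* Pick [n] above [|2b + 2/5| / (C - 4/5)], contradicting [bound n]; the absolute value covers
   negative [b]. *)
have := archi_boundP (divr_ge0 (normr_ge0 (2 * b + 2 / 5)) (ltW C45')).
rewrite ltr_pdivrMr //; set n := Num.bound _.
have := bound n; have := ler_norm (2 * b + 2 / 5); have := ler0n R n.
nra.
Qed.
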